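(* There is an absolute constant $K$ such that the following holds. Let $0<\epsilon\le1$ and $n=\lceil\log_2(8/\epsilon)\rceil$. Then there exists an $n$-qubit state $|\psi\rangle$, depending only on $\epsilon$, such that for every angle $\alpha\in[0,2\pi)$ there exist a CNOT circuit on $n$ qubits with unitary $W$ and an angle $\beta$ with $|\alpha-\beta|<\epsilon$ such that $$c(W)\big[(a|0\rangle+b|1\rangle)\otimes|\psi\rangle\big]=(a|0\rangle+be^{i\beta}|1\rangle)\otimes|\psi\rangle\qquad\text{for all } a,b\in\mathbb{C},$$ and $c(W)$ can be implemented with $T$-depth exactly $1$ using at most $Kn$ clean ancilla qubits (hence $O(\log(1/\epsilon))$ as $\epsilon\to 0$). In other words, the rotation $R_Z(\alpha)=\mathrm{diag}(1,e^{i\alpha})$ can be catalyzed up to precision $\epsilon$ in $T$-depth exactly $1$ using a universal $\lceil\log_2(8/\epsilon)\rceil$-qubit catalyst state.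
   Context: A CNOT circuit on $n$ qubits is a product of CNOT gates. For a unitary $W$ on $n$ qubits, $c(W)$ is the unitary on $n+1$ qubits with $c(W)(|0\rangle\otimes|\phi\rangle)=|0\rangle\otimes|\phi\rangle$ and $c(W)(|1\rangle\otimes|\phi\rangle)=|1\rangle\otimes W|\phi\rangle$. A catalyst state is an auxiliary state which is used but returned unchanged; universal means it does not depend on $\alpha$. Implementations of $c(W)$ are circuits of Clifford gates (generated by $H$, $S$, CNOT; not counted), $T=\mathrm{diag}(1,e^{i\pi/4})$ and $T^\dagger$ gates, single-qubit Pauli-basis measurements, and Clifford gates applied or not depending on earlier measurement outcomes. Clean ancillas are additional qubits initialized in $|0\rangle$. The circuit implements $c(W)$ if, for every input state of the $n+1$ qubits and every sequence of outcomes of non-zero probability, the final state of the $n+1$ qubits is $c(W)$ applied to the input (up to a global phase independent of the input), unentangled with the ancillas. $T$-depth is the number of layers of $T/T^\dagger$ gates, a layer being a set of such gates on distinct qubits, with only Clifford operations and measurements between layers. *)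

(* Defs.v *)
From HB Require Import structures.
From mathcomp Require Import all_boot all_order all_algebra.
From mathcomp Require Import complex.
From mathcomp Require Import all_classical all_reals all_analysis.

Set Implicit Arguments.
Unset Strict Implicit.
Unset Printing Implicit Defensive.

Import Order.TTheory GRing.Theory Num.Theory.
Import numFieldNormedType.Exports.

Local Open Scope ring_scope.

Inductive pauli := PauliX | PauliY | PauliZ.

(* Elementary Clifford gates on m qubits. [CNOT c t] has control c and
   target t, and is a gate only when c != t; see [clifford_ok]. *)
Inductive clifford (m : nat) :=
| Hgate of 'I_m
| Sgate of 'I_m
| CNOT of 'I_m & 'I_m.

(* [Cliff p g] applies g when p holds of the list of the measurement outcomes
   obtained so far (earliest first); an unconditional gate has p = xpredT.
   In [TLayer L] the qubit q receives no gate if L q = None, T if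
   L q = Some false, and T^dagger if L q = Some true. *)
Inductive instr (m : nat) :=
| Cliff of (seq bool -> bool) & clifford m
| Meas of pauli & 'I_m
| TLayer of {ffun 'I_m -> option bool}.

Definition circuit (m : nat) := seq (instr m).

(* Pairs (control, target), first gate first. *)
Definition cnot_circuit (m : nat) := seq ('I_m * 'I_m).

Definition cnot_circuit_ok m (W : cnot_circuit m) : bool :=
  all (fun g => g.1 != g.2) W.

Definition clifford_ok m (g : clifford m) : bool :=
  if g is CNOT c t then c != t else true.

Definition circuit_ok m (C : circuit m) : bool :=
  all (fun i => if i is Cliff _ g then clifford_ok g else true) C.

Definition nmeas m (C : circuit m) : nat :=
  count (fun i => if i is Meas _ _ then true else false) C.

(* A layer without any gate does not count. *)
Definition tdepth m (C : circuit m) : nat :=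
  count (fun i => if i is TLayer L then [exists q, L q != None] else false) C.

Definition bits (m : nat) := {ffun 'I_m -> bool}.

Definition bits_cat m k (x : bits m) (y : bits k) : bits (m + k) :=
  [ffun i => match fintype.split i with inl j => x j | inr j => y j end].

Definition bits_set m (x : bits m) (q : 'I_m) (b : bool) : bits m :=
  [ffun i => if i == q then b else x i].

Section Semantics.
Variable R : realType.

(* The vector space (C^2)^{\otimes m}: a vector is given by its amplitudes in
   the computational basis. A state is a vector of norm 1. *)
Definition qvec (m : nat) := {ffun bits m -> R[i]^o}.

(* A map on vectors; all those used below are linear. *)
Definition qop (m : nat) := qvec m -> qvec m.

Definition ket m (x : bits m) : qvec m := [ffun y => (y == x)%:R].

(* a|0> + b|1> *)
Definition qubit (a b : R[i]) : qvec 1 :=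
  [ffun x : bits 1 => if x ord0 then b else a].

(* The qubits of the left factor come first. *)
Definition tensor m k (u : qvec m) (v : qvec k) : qvec (m + k) :=
  [ffun x : bits (m + k) =>
     u [ffun i => x (lshift k i)] * v [ffun j => x (rshift m j)]].

Definition qnorm m (u : qvec m) : R[i] := sqrtC (\sum_x `|u x| ^+ 2).

(* e^{i t} *)
Definition cis (t : R) : R[i] := Complex (cos t) (sin t).

(* [apply1 M q] applies to the qubit q the 2 x 2 matrix whose entry in row r
   and column c is M r c. *)
Definition apply1 m (M : bool -> bool -> R[i]) (q : 'I_m) : qop m :=
  fun u => [ffun x : bits m => \sum_(c : bool) M (x q) c * u (bits_set x q c)].

Definition Hmx (r c : bool) : R[i] := (-1) ^+ (r && c) / sqrtC 2.

Definition Smx (r c : bool) : R[i] :=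
  if r == c then (if r then 'i else 1) else 0.

Definition Tmx (dagger r c : bool) : R[i] :=
  if r == c then (if r then cis (if dagger then - (pi / 4) else pi / 4) else 1)
  else 0.

Definition pauli_mx (P : pauli) (r c : bool) : R[i] :=
  match P with
  | PauliX => (r != c)%:R
  | PauliY => if r == c then 0 else if r then 'i else - 'i
  | PauliZ => if r == c then (-1) ^+ r else 0
  end.

(* The projector on the eigenspace of P for the eigenvalue (-1)^b. *)
Definition proj_mx (P : pauli) (b r c : bool) : R[i] :=
  ((r == c)%:R + (-1) ^+ b * pauli_mx P r c) / 2.

(* |x> goes to |x'> where x' is x with x t replaced by x t + x c; for c != t this
   permutation of the basis is its own inverse. *)
Definition apply_cnot m (c t : 'I_m) : qop m :=
  fun u => [ffun x : bits m => u (bits_set x t (x t (+) x c))].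

Definition apply_clifford m (g : clifford m) : qop m :=
  match g with
  | Hgate q => apply1 Hmx q
  | Sgate q => apply1 Smx q
  | CNOT c t => apply_cnot c t
  end.

(* The gates of a layer commute, so the order in which they are applied
   is irrelevant. *)
Definition apply_layer m (L : {ffun 'I_m -> option bool}) : qop m :=
  fun u => foldl (fun v q => if L q is Some d then apply1 (Tmx d) q v else v)
                 u (enum 'I_m).

Definition cnot_unitary m (W : cnot_circuit m) : qop m :=
  fun u => foldl (fun v g => apply_cnot g.1 g.2 v) u W.

(* u = |0> (x) slice false u + |1> (x) slice true u *)
Definition slice n (b : bool) (u : qvec (1 + n)) : qvec n :=
  [ffun y : bits n => u (bits_cat [ffun=> b] y)].

(* The controlled operator c(W); the control is the first qubit. *)
Definition ctrl n (W : qop n) : qop (1 + n) :=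
  fun u => tensor (qubit 1 0) (slice false u)
           + tensor (qubit 0 1) (W (slice true u)).

(* [exec C h o u] runs C on u when the outcomes of its measurements are the
   elements of o, in this order (false for the eigenvalue 1, true for -1); h is
   the list of the outcomes obtained before. Vectors are not renormalized after
   measurements: if u is a state and o has size nmeas C, then the squared norm
   of [exec C [::] o u] is the probability of o. *)
Fixpoint exec m (C : circuit m) (h o : seq bool) (u : qvec m) : qvec m :=
  match C with
  | [::] => u
  | Cliff p g :: C' => exec C' h o (if p h then apply_clifford g u else u)
  | Meas P q :: C' =>
      let b := head false o in
      exec C' (rcons h b) (behead o) (apply1 (proj_mx P b) q u)
  | TLayer L :: C' => exec C' h o (apply_layer L u)
  end.

(* C, which acts on m qubits followed by k clean ancillas, implements U: for
   each sequence o of outcomes there are a global phase and a final ancilla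
   state chi, both independent of the input xi, such that the final state is
   U xi (x) chi up to this phase whenever o has non-zero probability. *)
Definition implements m k (C : circuit (m + k)) (U : qop m) : Prop :=
  forall o : seq bool, size o = nmeas C ->
  exists (theta : R) (chi : qvec k), qnorm chi = 1 /\
  forall xi : qvec m, qnorm xi = 1 ->
    let v := exec C [::] o (tensor xi (ket [ffun=> false])) in
    qnorm v != 0 -> (qnorm v)^-1 *: v = cis theta *: tensor (U xi) chi.

(* The number of qubits of the catalyst, ceil (log_2 (8 / eps)). *)
Definition catalyst_size (eps : R) : nat := `|Num.ceil (ln (8 / eps) / ln 2)|%N.

End Semantics.

Arguments cnot_unitary R {m} W.

(* Main.v *)
Require Import Defs.
From HB Require Import structures.
From mathcomp Require Import all_boot all_order all_algebra.
From mathcomp Require Import all_fingroup all_solvable all_field.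
From mathcomp Require Import complex.
From mathcomp Require Import all_classical all_reals all_analysis.
From mathcomp Require Import zify ring lra.

Set Implicit Arguments.
Unset Strict Implicit.
Unset Printing Implicit Defensive.

Import Order.TTheory GRing.Theory Num.Theory.
Import numFieldNormedType.Exports.

Local Open Scope classical_set_scope.
Local Open Scope ring_scope.

(* Identify the n-bit strings with the field of 2 ^ n elements, let g generate
   its multiplicative group and put N = 2 ^ n - 1. Multiplication by g is linear
   over F_2, hence so are its powers, which are therefore CNOT circuits by
   Gauss-Jordan elimination. The uniform superposition of the |g^j> with phases
   e^{2 pi i j / N} is a common eigenvector of all of them, and the eigenvalue
   for g^k is e^{2 pi i k / N}; since N >= 7 / eps, these angles are dense
   enough.

   To control y |-> A y by a qubit c, write A = P^-1. First compute t = c B y,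
   with B = 1 + A, in n fresh qubits: this is one CCZ gate per qubit of t between
   two Hadamard gates. All the CCZ gates are diagonal, so they need a single
   layer of T gates once the relevant parities are copied to ancillas. Then add
   t to y, which becomes A^c y. As a function of the new y, one has
   t = c (1 + P) y, so that measuring t in the X basis with outcomes o leaves
   the sign (-1)^(o . c (1 + P) y), which is corrected by CZ gates. *)

(** * The multiplicative group of the field with 2 ^ n elements *)

(** A field with 2 ^ n elements is an F_2-vector space of dimension n, and [phi] reads a bit string
    as coordinates in a basis. Addition in [bits n] is pointwise exclusive or. *)
Lemma field_bits n : (0 < n)%N ->
  exists (F : finFieldType) (phi : bits n -> F),
  [/\ #|F| = (2 ^ n)%N, {morph phi : x y / x + y} & bijective phi].
Proof.
move=> n0; have [F F2 cF] := @pPrimePowerField 2 n isT n0.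
exists F; have := pprimeChar_vectAxiom F2.
rewrite (_ : logn 2 _ = n); last by rewrite [X in logn _ X]cF pfactorK.
case=> v2r v2rL [r2v v2rK r2vK].
pose f (b : bool) : 'F_2 := b%:R.
have fD a b : f (a + b) = f a + f b by case: a; case: b; apply/val_inj.
pose r (x : bits n) : 'rV['F_2]_n := \row_i f (x i).
have rD x y : r (x + y) = r x + r y by apply/rowP => i; rewrite !mxE ffunE fD.
pose s (v : 'rV['F_2]_n) : bits n := [ffun i => v 0 i != 0].
have rK : cancel r s by move=> x; apply/ffunP => i; rewrite ffunE mxE; case: (x i).
have sK : cancel s r.
  by move=> v; apply/rowP => i; rewrite mxE ffunE; apply/val_inj; case: (v 0 i) => [[|[|]]].
exists (fun x => r2v (r x)); split => //.
  move=> x y; apply: (can_inj v2rK); rewrite rD r2vK.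
  have := v2rL 1 (r2v (r x)) (r2v (r y)).
  by rewrite !scale1r !r2vK.
by exists (fun z => s (v2r z)) => x; rewrite ?r2vK ?rK // sK v2rK.
Qed.

(** [P] is multiplication by a generator of the cyclic group of units, carried over to bit strings,
    and [x0] stands for 1. The orbit of [x0] is thus the set of nonzero strings, and exponents
    matter modulo the order 2 ^ n - 1. *)
Lemma singer_cycle n : (0 < n)%N ->
  exists (P : bits n -> bits n) (x0 : bits n),
  [/\ {morph P : x y / x + y},
      forall x, x != 0 -> exists i, x = iter i P x0,
      forall i, iter i P x0 != 0 &
      forall i j, iter i P x0 = iter j P x0 -> (i == j %[mod (2 ^ n).-1])%N].
Proof.
move=> /field_bits [F [phi [cF phiD [psi phiK psiK]]]].
have phi0 : phi 0 = 0 by apply: (addrI (phi 0)); rewrite -phiD !addr0.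
have [g gG] : exists g : {unit F}, <[g]>%g = [set: {unit F}]%SET.
  by have /cyclicP [g ->] := field_unit_group_cyclic [set: {unit F}]%G; exists g.
have og : #[g]%g = (2 ^ n).-1 by rewrite /order gG card_finField_unit cF.
pose P x := psi (val g * phi x).
have PE i : iter i P (psi 1) = psi (val (g ^+ i)%g).
  elim: i => [|i IH]; first by rewrite expg0.
  by rewrite iterS IH /P psiK expgS.
exists P, (psi 1); split => [x y|x x0|i|i j].
- by apply: (can_inj phiK); rewrite phiD !psiK phiD mulrDr.
- have ux : phi x \is a GRing.unit.
    by rewrite unitfE -phi0 (inj_eq (can_inj phiK)).
  have : FinRing.unit F ux \in <[g]>%g by rewrite gG finset.in_setT.
  by case/cycleP => i E; exists i; rewrite PE -E /= phiK.
- rewrite PE; apply/eqP => E.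
  have := congr1 phi E; rewrite psiK phi0 => {}E.
  by have := valP (g ^+ i)%g; rewrite E unitr0.
- by rewrite !PE => /(can_inj psiK)/val_inj /eqP; rewrite eq_expg_mod_order og.
Qed.

(** * Synthesis of CNOT circuits *)

Definition cnot_map m (c t : 'I_m) (x : bits m) : bits m :=
  bits_set x t (x t (+) x c).

(** Gates pull amplitudes back, which reverses composition: the last gate of [W] is the first to act
    on [x], whence [foldr]. *)
Definition cnot_perm m (W : cnot_circuit m) (x : bits m) : bits m :=
  foldr (fun g => cnot_map g.1 g.2) x W.

Lemma cnot_perm_cons m g (W : cnot_circuit m) x :
  cnot_perm (g :: W) x = cnot_map g.1 g.2 (cnot_perm W x).
Proof. by []. Qed.

Definition basis_bits m (j : 'I_m) : bits m := [ffun i => i == j].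

Lemma cnot_unitaryE (R : realType) m (W : cnot_circuit m) (u : qvec R m) x :
  cnot_unitary R W u x = u (cnot_perm W x).
Proof. by elim: W u x => //= g W IH u x; rewrite [LHS]IH ffunE. Qed.

Lemma cnot_perm_cat m (V W : cnot_circuit m) x :
  cnot_perm (V ++ W) x = cnot_perm V (cnot_perm W x).
Proof. by rewrite /cnot_perm foldr_cat. Qed.

Lemma cnot_mapD m (c t : 'I_m) : {morph cnot_map c t : x y / x + y}.
Proof.
move=> x y; apply/ffunP => i; rewrite /cnot_map /bits_set !ffunE; case: eqP => // _.
by rewrite -![_ (+) _]/(_ + _) addrACA.
Qed.

Lemma cnot_permD m (W : cnot_circuit m) : {morph cnot_perm W : x y / x + y}.
Proof.
by elim: W => // g W IH x y; rewrite !cnot_perm_cons IH cnot_mapD.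
Qed.

(** No target is ever a control, so the controls keep their initial values and the gates just
    accumulate these in the targets. *)
Lemma cnot_perm_bipartite m (W : cnot_circuit m) (x : bits m) :
  (forall g h, g \in W -> h \in W -> g.1 != h.2) ->
  cnot_perm W x = [ffun q => x q + \sum_(g <- W | g.2 == q) x g.1].
Proof.
elim: W => [_|g W IH].
  by apply/ffunP => q; rewrite ffunE big_nil addr0.
move=> H; rewrite cnot_perm_cons IH; last by move=> ? ? gW hW; apply: H; rewrite inE ?gW ?hW orbT.
apply/ffunP => q; rewrite /cnot_map /bits_set !ffunE big_cons eq_sym.
have -> : \sum_(h <- W | h.2 == g.1) x h.1 = 0.
  rewrite big_seq_cond big1 // => h /andP[hW /eqP hE].
  by have := H g h; rewrite -hE !inE eqxx hW orbT => /(_ isT isT); rewrite eqxx.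
rewrite addr0; case: eqP => [->|//]; rewrite -[_ (+) _]/(_ + _) -addrA; congr (_ + _).
by rewrite addrC.
Qed.

Lemma addbits_self m (x : bits m) : x + x = 0.
Proof. by apply/ffunP => i; rewrite !ffunE; exact: addbb. Qed.

(** The second pass reads the same controls, so each target receives the same sum twice, which
    vanishes modulo 2. *)
Lemma cnot_perm_bipartiteK m (W : cnot_circuit m) :
  (forall g h, g \in W -> h \in W -> g.1 != h.2) ->
  involutive (cnot_perm W).
Proof.
move=> H x; rewrite !cnot_perm_bipartite //; apply/ffunP => q.
rewrite !ffunE -addrA -big_split /= big_seq_cond big1 ?addr0 // => g /andP[gW _].
rewrite ffunE big_seq_cond big1 ?addr0; first exact: addbb.
by move=> h /andP[hW /eqP hg]; have := H _ _ gW hW; rewrite hg eqxx.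
Qed.

Lemma bits_basis m (x : bits m) : x = \sum_(j | x j) basis_bits j.
Proof.
apply/ffunP => i; rewrite sum_ffunE (eq_bigr (fun j => (i == j : bool))); last first.
  by move=> j _; rewrite ffunE.
case xi: (x i).
  by rewrite (bigD1 i) //= eqxx big1 ?addr0 // => j /andP[_]; rewrite eq_sym => /negPf.
by rewrite big1 // => j xj; case: eqP => // ij; rewrite ij xj in xi.
Qed.

(* Gauss-Jordan elimination, column by column: the columns of index < k of the
   matrix of P are already those of the identity. *)
Lemma cnot_synthesis_from m (P : bits m -> bits m) (k : nat) :
  {morph P : x y / x + y} -> injective P -> (k <= m)%N ->
  (forall j : 'I_m, (j < k)%N -> P (basis_bits j) = basis_bits j) ->
  exists2 W : cnot_circuit m, cnot_circuit_ok W & cnot_perm W =1 P.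
Proof.
have [d] := ubnP (m - k); elim: d k P => // d IH k P mk PD Pinj.
have P0 : P 0 = 0 by apply: (addrI (P 0)); rewrite -PD !addr0.
rewrite leq_eqVlt => /orP[/eqP ->|km] Pk.
  exists [::] => // x; rewrite [in RHS](bits_basis x) (big_morph P PD P0).
  by rewrite [LHS](bits_basis x); apply: eq_bigr => j _; rewrite Pk.
pose K := Ordinal km; pose v := P (basis_bits K).
(* A pivot on or below the diagonal: otherwise [v] is a sum of basis strings fixed by [P], so
   [P v = v = P (basis_bits K)], and injectivity gives [v = basis_bits K], whose entry [K] is
   true. *)
have [i ki vi] : exists2 i : 'I_m, (k <= i)%N & v i.
  apply/exists_inP; rewrite -[X in is_true X]negbK negb_exists_in; apply/negP => /forall_inP H.
  have vE : v = P v.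
    rewrite [in RHS](bits_basis v) (big_morph P PD P0) [LHS](bits_basis v).
    by apply: eq_bigr => j vj; rewrite Pk // ltnNge; apply/negP => /H; rewrite vj.
  move/Pinj: vE => /(congr1 (fun z : bits m => z K)); rewrite ffunE eqxx => vK.
  by have /= := H K (leqnn k); rewrite -vK.
(* [D0] makes the diagonal entry true and [D1] below clears the rest of column [K]. Their controls
   have index at least [k], where the earlier basis strings vanish, so the earlier columns
   survive. *)
pose D0 : cnot_circuit m := if v K then [::] else [:: (i, K)].
have D0ok : cnot_circuit_ok D0.
  rewrite /D0; case: ifP => //= vK; rewrite andbT.
  by apply: contraFneq vK => <-.
have D0bip g h : g \in D0 -> h \in D0 -> g.1 != h.2.
  move: D0ok; rewrite /D0; case: ifP => // _.
  by rewrite !inE /= andbT => H /eqP -> /eqP ->.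
have D0k (j : 'I_m) : (j < k)%N -> cnot_perm D0 (basis_bits j) = basis_bits j.
  move=> jk; rewrite cnot_perm_bipartite //; apply/ffunP => q.
  rewrite ffunE big_seq_cond big1 ?addr0 // => g /andP[+ _]; rewrite /D0.
  case: ifP => // _; rewrite inE => /eqP -> /=.
  by rewrite ffunE -val_eqE gtn_eqF // (leq_trans jk).
pose v' := cnot_perm D0 v.
have v'K : v' K.
  rewrite /v' cnot_perm_bipartite // ffunE /D0; case: ifP => _.
    by rewrite big_nil addr0.
  by rewrite big_cons big_nil /= eqxx vi addr0.
pose D1 : cnot_circuit m := [seq (K, r) | r <- enum 'I_m & (r != K) && v' r].
have D1in g : g \in D1 -> [/\ g.1 = K, g.2 != K & v' g.2].
  by case/mapP => r; rewrite mem_filter => /andP[/andP[rK vr] _] ->.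
have D1bip g h : g \in D1 -> h \in D1 -> g.1 != h.2.
  by move=> /D1in[-> _ _] /D1in[_ + _]; rewrite eq_sym.
have D1ok : cnot_circuit_ok D1 by apply/allP => g gD; apply: D1bip.
have D1k (j : 'I_m) : (j < k)%N -> cnot_perm D1 (basis_bits j) = basis_bits j.
  move=> jk; rewrite cnot_perm_bipartite //; apply/ffunP => q.
  rewrite ffunE big_seq_cond big1 ?addr0 // => g /andP[/D1in[-> _ _] _].
  by rewrite ffunE -val_eqE gtn_eqF.
have D1v : cnot_perm D1 v' = basis_bits K.
  rewrite cnot_perm_bipartite //; apply/ffunP => q; rewrite !ffunE big_map big_filter_cond /=.
  case: (eqVneq q K) => [->|qK].
    rewrite v'K big1 ?addr0 // => r /andP[/andP[rK _] /eqP rE].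
    by rewrite rE eqxx in rK.
  case vq: (v' q).
    rewrite big_enum_cond /= (big_pred1 q); first by rewrite v'K.
    move=> r /=; case: (eqVneq r q) => [->|]; by rewrite ?qK ?vq ?andbF.
  by rewrite big1 ?addr0 // => r /andP[/andP[_ vr] /eqP rE]; rewrite rE vq in vr.
have [|||||W Wok WE] := IH k.+1 (cnot_perm D1 \o cnot_perm D0 \o P).
- by rewrite -(ltn_add2r 1) !addn1 in mk *; rewrite subnSK.
- by move=> x y /=; rewrite PD !cnot_permD.
- by apply: inj_comp => //; apply: inj_comp; apply: inv_inj; apply: cnot_perm_bipartiteK.
- by [].
- move=> j; rewrite ltnS leq_eqVlt => /orP[/eqP jK|jk] /=; last by rewrite Pk // D0k // D1k.
  by rewrite (_ : j = K) //; apply/val_inj.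
(* [W] realizes [P] followed by [D0] and [D1]; both are involutions, so applying [D1] and then [D0]
   undoes them. *)
exists (D0 ++ D1 ++ W); first by rewrite /cnot_circuit_ok !all_cat; apply/and3P.
move=> x; rewrite !cnot_perm_cat WE /=.
by rewrite !cnot_perm_bipartiteK.
Qed.

Lemma cnot_synthesis m (P : bits m -> bits m) :
  {morph P : x y / x + y} -> injective P ->
  exists2 W : cnot_circuit m, cnot_circuit_ok W & cnot_perm W =1 P.
Proof. by move=> PD Pinj; apply: (@cnot_synthesis_from m P 0). Qed.

(** * The catalyst *)

Lemma cisD (R : realType) (s t : R) : cis (s + t) = cis s * cis t.
Proof. by rewrite /cis cosD sinD; congr Complex; rewrite addrC. Qed.
Lemma cis0 (R : realType) : cis 0 = 1 :> R[i].
Proof. by rewrite /cis cos0 sin0. Qed.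
Lemma cisMn (R : realType) (t : R) k : cis (t *+ k) = cis t ^+ k.
Proof. by elim: k => [|k IH]; rewrite ?cis0 // mulrS cisD IH exprS. Qed.
Lemma norm_cis (R : realType) (t : R) : `|cis t| = 1.
Proof. by rewrite normc_def /= cos2Dsin2 sqrtr1. Qed.

(** * Bit strings on two registers and norms of tensor products *)

Lemma bits_cat_lshift m k (x : bits m) (y : bits k) i :
  bits_cat x y (lshift k i) = x i.
Proof. by rewrite ffunE (unsplitK (inl i)). Qed.

Lemma bits_cat_rshift m k (x : bits m) (y : bits k) j :
  bits_cat x y (rshift m j) = y j.
Proof. by rewrite ffunE (unsplitK (inr j)). Qed.

Definition lbits m k (x : bits (m + k)) : bits m := [ffun i => x (lshift k i)].
Definition rbits m k (x : bits (m + k)) : bits k := [ffun j => x (rshift m j)].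

Lemma bits_catK m k (x : bits (m + k)) : bits_cat (lbits x) (rbits x) = x.
Proof.
by apply/ffunP => i; rewrite ffunE; case: (split_ordP i) => j ->; rewrite ffunE.
Qed.

Lemma lbits_cat m k (x : bits m) (y : bits k) : lbits (bits_cat x y) = x.
Proof. by apply/ffunP => i; rewrite ffunE bits_cat_lshift. Qed.

Lemma rbits_cat m k (x : bits m) (y : bits k) : rbits (bits_cat x y) = y.
Proof. by apply/ffunP => i; rewrite ffunE bits_cat_rshift. Qed.

Lemma sum_bits_cat (V : nmodType) m k (F : bits (m + k) -> V) :
  \sum_x F x = \sum_(x : bits m) \sum_(y : bits k) F (bits_cat x y).
Proof.
rewrite pair_big /= (reindex (fun p => bits_cat p.1 p.2)) //=.
exists (fun x => (lbits x, rbits x)) => [[x y] _|x _] /=; last exact: bits_catK.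
by rewrite lbits_cat rbits_cat.
Qed.

Section States.
Variable R : realType.

Lemma tensorE m k (u : qvec R m) (v : qvec R k) x :
  tensor u v x = u (lbits x) * v (rbits x).
Proof. by rewrite ffunE. Qed.

Lemma qubitE (a b : R[i]) y : qubit a b y = if y ord0 then b else a.
Proof. by rewrite ffunE. Qed.

(** At each basis state only the slice selected by the control bit contributes. *)
Lemma ctrl_permE n (U : qop R n) (P : bits n -> bits n) (u : qvec R (1 + n)) x :
  (forall v y, U v y = v (P y)) ->
  ctrl U u x = u (bits_cat (lbits x) (if lbits x ord0 then P (rbits x) else rbits x)).
Proof.
move=> UE; rewrite /ctrl [LHS]ffunE !tensorE [slice false u _]ffunE UE [slice true u _]ffunE.
have lE b : lbits x ord0 = b -> lbits x = [ffun=> b].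
  move=> <-; apply/ffunP => i; by rewrite [RHS]ffunE (ord1 i).
rewrite !qubitE.
by case E: (lbits x ord0); rewrite (lE _ E) !(mul0r, mul1r, add0r, addr0).
Qed.

Lemma qnorm_tensor m k (u : qvec R m) (v : qvec R k) :
  qnorm (tensor u v) = qnorm u * qnorm v.
Proof.
rewrite /qnorm -rootCMl ?sumr_ge0 //.
congr sqrtC; rewrite sum_bits_cat big_distrl; apply: eq_bigr => x _.
rewrite big_distrr; apply: eq_bigr => y _ /=.
by rewrite tensorE lbits_cat rbits_cat normrM exprMn.
Qed.

Lemma qnormZ m (c : R[i]) (u : qvec R m) : qnorm (c *: u) = `|c| * qnorm u.
Proof.
rewrite /qnorm -[X in X * _]sqrCK // -rootCMl ?exprn_ge0 //; congr sqrtC.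
by rewrite big_distrr; apply: eq_bigr => x _; rewrite /= ffunE normrM exprMn.
Qed.

Lemma qnorm_perm m (u : qvec R m) (f g : bits m -> bits m) :
  cancel f g -> cancel g f -> qnorm ([ffun x => u (f x)] : qvec R m) = qnorm u.
Proof.
move=> fK gK; congr sqrtC; rewrite [RHS](reindex f); last by exists g => x _.
by apply: eq_bigr => x _; rewrite ffunE.
Qed.

End States.

Section Catalyst.
Variables (R : realType) (n : nat).
Hypothesis n_gt0 : (0 < n)%N.
Let N := (2 ^ n).-1.
Let w : R[i] := cis (2 * pi / N%:R).

Let N_gt0 : (0 < N)%N.
Proof. by rewrite /N -ltnS prednK ?expn_gt0 // (ltn_exp2l 0). Qed.

Let wN : w ^+ N = 1.
Proof.
rewrite /w -cisMn -[_ *+ N]mulr_natr divfK ?pnatr_eq0 -?lt0n //.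
rewrite mulr_natl /cis -[pi *+ 2]add0r.
by rewrite (cosD2pi 0) (sinD2pi 0) cos0 sin0.
Qed.

Lemma catalyst_state : exists psi : qvec R n, qnorm psi = 1 /\
  forall k : nat, exists2 W : cnot_circuit n, cnot_circuit_ok W &
    cnot_unitary R W psi = cis (2 * pi * k%:R / N%:R) *: psi.
Proof.
have [P [x0 [PD Psurj P_neq0 Pinj]]] := singer_cycle n_gt0.
have P0 : P 0 = 0 by apply: (addrI (P 0)); rewrite -PD !addr0.
(* The discrete logarithm, totalized at 0 by the implication. It is determined only modulo [N],
   which suffices since [w ^+ N = 1]. *)
have ex_log (x : bits n) : exists i, (x != 0) ==> (x == iter i P x0).
  by have [->|/Psurj[i ->]] := eqVneq x 0; [exists 0%N | exists i; rewrite eqxx].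
pose log (x : bits n) := xchoose (ex_log x).
have logE x : x != 0 -> x = iter (log x) P x0.
  by move=> xN; apply/eqP; move/implyP: (xchooseP (ex_log x)); apply.
have w_log i : w ^+ log (iter i P x0) = w ^+ i.
  have /esym/Pinj/eqP := logE _ (P_neq0 i).
  have wmod j : w ^+ j = w ^+ (j %% N)%N.
    by rewrite {1}(divn_eq j N) exprD mulnC exprM wN expr1n mul1r.
  by rewrite wmod => ->; rewrite -wmod.
have Pker x : P x = 0 -> x = 0.
  move=> Px; have [//|/Psurj[i xE]] := eqVneq x 0.
  by have := P_neq0 i.+1; rewrite iterS -xE Px eqxx.
have Pinjective : injective P.
  move=> x y Pxy; have /Pker : P (x - y) = 0.
    by rewrite PD Pxy -PD addrC addNr.
  by move/eqP; rewrite subr_eq0 => /eqP.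
(* The string 0 lies outside the orbit and gets amplitude 0; the other [N] amplitudes have squared
   modulus 1 / N. *)
pose psi : qvec R n := [ffun x : bits n => if x == 0 then 0 else w ^+ log x / sqrtC N%:R].
have psiP k x : psi (iter k P x) = w ^+ k * psi x.
  rewrite !ffunE; have [->|xN] := eqVneq x 0.
    by rewrite mulr0 (_ : iter k P 0 == 0) //; elim: k => //= k /eqP ->; rewrite P0.
  by rewrite mulrA [in LHS](logE x xN) -iterD (negPf (P_neq0 _)) w_log exprD.
exists psi; split.
  rewrite /qnorm (bigD1 (0 : bits n)) //= ffunE eqxx normr0 expr0n add0r.
  rewrite (eq_bigr (fun=> N%:R^-1)) => [|x xN].
    rewrite sumr_const.
    have -> : #|[pred x : bits n | x != 0]| = N.
      by rewrite (eq_card (B := predC1 (0 : bits n))) // cardC1 card_ffun card_bool card_ord.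
    by rewrite -[_ *+ N]mulr_natr mulVf ?sqrtC1 // pnatr_eq0 -lt0n.
  rewrite ffunE (negPf xN) normrM normfV normrX norm_cis expr1n mul1r.
  by rewrite ger0_norm ?sqrtC_ge0 ?ler0n // exprVn sqrtCK.
move=> k; have Pk : {morph iter k P : x y / x + y}.
  by elim: k => // k IH x y; rewrite !iterS IH PD.
have Pk_inj : injective (iter k P) by elim: k {Pk} => //= k IH x y /Pinjective/IH.
have [W Wok WE] := cnot_synthesis Pk Pk_inj.
exists W => //; apply/ffunP => x.
rewrite cnot_unitaryE WE psiP [RHS]ffunE /w -cisMn; congr (cis _ * _).
by rewrite -[_ *+ k]mulr_natr mulrAC.
Qed.

End Catalyst.

(** * Gates on superpositions *)

Lemma bits_set_same m (x : bits m) q b : bits_set x q b q = b.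
Proof. by rewrite ffunE eqxx. Qed.

Lemma bits_set_other m (x : bits m) q b p : p != q -> bits_set x q b p = x p.
Proof. by move=> pq; rewrite ffunE (negPf pq). Qed.

Lemma bits_set_id m (x : bits m) q : bits_set x q (x q) = x.
Proof. by apply/ffunP => i; rewrite ffunE; case: eqP => // ->. Qed.

Lemma bits_set_set m (x : bits m) q b c : bits_set (bits_set x q b) q c = bits_set x q c.
Proof. by apply/ffunP => i; rewrite !ffunE; case: eqP. Qed.

(** Row [i] of the matrix of [B] selects the coordinates of [y] to be summed. This links gates
    chosen by matrix entries to values of linear maps. *)
Lemma lin_coord m (B : bits m -> bits m) y i : {morph B : x y / x + y} ->
  B y i = \sum_(k | B (basis_bits k) i) y k.
Proof.
move=> BD; have B0 : B 0 = 0 by apply: (addrI (B 0)); rewrite -BD !addr0.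
rewrite {1}(bits_basis y) (big_morph B BD B0) sum_ffunE [LHS]big_mkcond [RHS]big_mkcond.
by apply: eq_bigr => k _; case: (y k); case: (B _ i).
Qed.

(** The nontrivial character of the additive group of [bool], whose addition is exclusive or. *)
Definition bsign (R : realType) (b : bool) : R[i] := (-1) ^+ b.

Lemma bsignD (R : realType) (a b : bool) : bsign R (a + b)%R = bsign R a * bsign R b.
Proof. exact: signr_addb. Qed.

Section Gates.
Variables (R : realType) (m : nat).
Implicit Types (u : qvec R m) (x : bits m).

Lemma apply1E M q u x : apply1 M q u x =
  M (x q) true * u (bits_set x q true) + M (x q) false * u (bits_set x q false).
Proof. by rewrite ffunE big_bool. Qed.

Lemma apply_cnotE (c t : 'I_m) u x : apply_cnot c t u x = u (cnot_map c t x).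
Proof. by rewrite ffunE. Qed.

(* A product state on the qubits t i, with coefficients depending on the
   basis state of the other qubits, remains one under gates on the t i. *)
Lemma apply_each_seq (I : finType) (t : I -> 'I_m)
    (M : I -> bool -> bool -> R[i]) (s : seq I) (f : bits m -> R[i])
    (g : I -> bits m -> bool -> R[i]) u :
  injective t -> uniq s ->
  (forall x i b, f (bits_set x (t i) b) = f x) ->
  (forall j x i b, g j (bits_set x (t i) b) =1 g j x) ->
  (forall x, u x = f x * \prod_i g i x (x (t i))) ->
  forall x, foldl (fun v i => apply1 (M i) (t i) v) u s x =
    f x * \prod_i (if i \in s then \sum_(c : bool) M i (x (t i)) c * g i x c
                   else g i x (x (t i))).
Proof.
move=> tI; elim: s g u => [|j s IH] g u /=; first by move=> _ _ _ uE x; rewrite uE.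
move=> /andP[js s_uniq] fI gI uE x.
(* The gate on [t j] changes only the coefficient of that qubit, to its image under [M j]. *)
pose g' i x b := if i == j then \sum_(c : bool) M j b c * g j x c else g i x b.
rewrite (IH g') //; first last.
- move=> {}x; rewrite ffunE (bigD1 j) //= /g' eqxx big_distrl big_distrr /=.
  apply: eq_bigr => c _; rewrite uE fI (bigD1 j) //= bits_set_same gI.
  rewrite [LHS]mulrCA; congr (_ * _); rewrite -mulrA; congr (_ * (_ * _)).
  apply: eq_bigr => i ij; rewrite (negPf ij) gI bits_set_other //.
  by rewrite (inj_eq tI).
- move=> i z k b c; rewrite /g'; case: eqP => // _; last by rewrite gI.
  by apply: eq_bigr => d _; rewrite gI.
congr (_ * _); apply: eq_bigr => i _; rewrite inE /g'.
by have [->|] := eqVneq i j; [rewrite (negPf js) | case: (i \in s)].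
Qed.

Lemma apply_each (I : finType) (t : I -> 'I_m)
    (M : I -> bool -> bool -> R[i]) (f : bits m -> R[i])
    (g : I -> bits m -> bool -> R[i]) u :
  injective t ->
  (forall x i b, f (bits_set x (t i) b) = f x) ->
  (forall j x i b, g j (bits_set x (t i) b) =1 g j x) ->
  (forall x, u x = f x * \prod_i g i x (x (t i))) ->
  forall x, foldl (fun v i => apply1 (M i) (t i) v) u (enum I) x =
    f x * \prod_i (\sum_(c : bool) M i (x (t i)) c * g i x c).
Proof.
move=> tI fI gI uE x; rewrite (apply_each_seq M tI (enum_uniq I) fI gI uE).
by congr (_ * _); apply: eq_bigr => i _; rewrite mem_enum.
Qed.

(** All gates of a layer are diagonal, so each one multiplies the amplitude by a diagonal entry. *)
Lemma apply_layerE (L : {ffun 'I_m -> option bool}) u x :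
  apply_layer L u x =
  (\prod_q (if L q is Some d then Tmx R d (x q) (x q) else 1)) * u x.
Proof.
rewrite /apply_layer -big_enum /=; elim: (enum _) u => [|q s IH] u.
  by rewrite big_nil mul1r.
rewrite /= IH big_cons -[RHS]mulrA [RHS]mulrCA; congr (_ * _).
case: (L q) => [d|]; last by rewrite mul1r.
rewrite apply1E -[u x in RHS](congr1 u (bits_set_id x q)) /Tmx.
by case: (x q); rewrite !(mul0r, add0r, addr0).
Qed.

Lemma invsqrt2_sqr : (sqrtC 2)^-1 * (sqrtC 2)^-1 = 2^-1 :> R[i].
Proof. by rewrite -invfM -expr2 sqrtCK. Qed.

(** Hadamard gates on the target exchange X and Z there, which turns CNOT into CZ. *)
Lemma cz_phase (c t : 'I_m) u x : c != t ->
  apply1 (@Hmx R) t (apply_cnot c t (apply1 (@Hmx R) t u)) x =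
  bsign R (x c * x t)%R * u x.
Proof.
move=> ct; rewrite [LHS]apply1E !apply_cnotE !apply1E /cnot_map !bits_set_same.
rewrite !bits_set_set !(bits_set_other _ _ ct) -[u x in RHS](congr1 u (bits_set_id x t)) /Hmx.
set r := (sqrtC 2)^-1.
(* Inserting this factor makes both sides homogeneous of degree two in [r], so that [ring] closes
   every case without the value of [r]. *)
have key z : z = 2 * (r * r) * z by rewrite invsqrt2_sqr mulfV ?pnatr_eq0 // mul1r.
by rewrite [RHS]key /bsign; case: (x c); case: (x t); rewrite /=; ring.
Qed.

(** Clifford gates leave the history [h] alone, so [p] has the same value for the whole list. *)
Lemma exec_cliffords p (gs : seq (clifford m)) C h o u :
  exec ([seq Cliff p g | g <- gs] ++ C) h o u =
  exec C h o (if p h then foldl (fun v g => apply_clifford g v) u gs else u).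
Proof.
elim: gs u => [|g gs IH] u /=; first by case: (p h).
by rewrite IH; case: (p h).
Qed.

Lemma exec_cnots (W : cnot_circuit m) C h o u :
  exec ([seq Cliff xpredT (CNOT g.1 g.2) | g <- W] ++ C) h o u =
  exec C h o (cnot_unitary R W u).
Proof. by elim: W u => //= g W IH u; rewrite IH. Qed.

Lemma exec_hadamards (I : Type) (t : I -> 'I_m) (s : seq I) C h o u :
  exec ([seq Cliff xpredT (Hgate (t i)) | i <- s] ++ C) h o u =
  exec C h o (foldl (fun v i => apply1 (@Hmx R) (t i) v) u s).
Proof. by elim: s u => //= q s IH u; rewrite IH. Qed.

Lemma exec_measurements (I : Type) (P : pauli) (t : I -> 'I_m) (a : I -> bool)
    (s : seq I) C h o u :
  exec ([seq Meas P (t i) | i <- s] ++ C) h (map a s ++ o) u =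
  exec C (h ++ map a s) o (foldl (fun v i => apply1 (@Defs.proj_mx R P (a i)) (t i) v) u s).
Proof.
elim: s h u => [|i s IH] h u /=; first by rewrite cats0.
by rewrite IH cat_rcons.
Qed.

(** Each triple of gates under one condition is a conditional CZ by [cz_phase]; the signs multiply,
    so their exponents add modulo 2. *)
Lemma exec_cz (I : Type) (p : I -> seq bool -> bool) (c : 'I_m) (t : I -> 'I_m)
    (s : seq I) h u x : (forall i, c != t i) ->
  exec (flatten [seq [seq Cliff (p i) g
         | g <- [:: Hgate (t i); CNOT c (t i); Hgate (t i)]] | i <- s]) h [::] u x
  = bsign R (\sum_(i <- s) p i h * (x c * x (t i)))%R * u x.
Proof.
move=> ct; elim: s u => [|i s IH] u; first by rewrite big_nil mul1r.
rewrite map_cons -[flatten _]/(_ ++ flatten _).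
rewrite exec_cliffords IH big_cons bsignD [RHS]mulrAC [RHS]mulrC; congr (_ * _).
case: (p i h); last by rewrite mul0r mul1r.
by rewrite /= cz_phase // mul1r.
Qed.

End Gates.

(** * Controlled CNOT circuits in T-depth one *)

Lemma prod_bool (S : comNzRingType) (I : finType) (b : I -> bool) :
  \prod_i (b i)%:R = ([forall i, b i])%:R :> S.
Proof.
case: (boolP [forall i, b i]) => [/forallP bT|/forallPn[i /negPf bF]].
  by rewrite big1 // => i _; rewrite bT.
by rewrite (bigD1 i) //= bF mul0r.
Qed.

Lemma bsign_prod (R : realType) (I : Type) (s : seq I) (b : I -> bool) :
  bsign R (\sum_(i <- s) b i)%R = \prod_(i <- s) bsign R (b i).
Proof. exact: (big_morph (bsign R) (@bsignD R) (erefl : bsign R false = 1)). Qed.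

(** [e] is the indicator of a subset of the three bits; [parity e true true true] is the parity of
    its size. *)
Definition parity (e : bool * bool * bool) (c t z : bool) : bool :=
  (e.1.1 && c) (+) (e.1.2 && t) (+) (e.2 && z).

(* 4 c t z = c + t + z - (c+t) - (c+z) - (t+z) + (c+t+z), where the sums in
   brackets are modulo 2: T on the parities of odd weight and T^dagger on those
   of even weight implement a CCZ gate; the empty parity contributes 1. *)
Lemma ccz_phase (R : realType) (c t z : bool) :
  \prod_(e : bool * bool * bool)
    Tmx R (~~ parity e true true true) (parity e c t z) (parity e c t z)
  = bsign R [&& c, t & z].
Proof.
set w : R[i] := cis (pi / 4); set w' : R[i] := cis (- (pi / 4)).
have ww' : w * w' = 1 by rewrite -cisD addrN cis0.
have w4 : w ^+ 4 = -1.
  rewrite -cisMn -[_ *+ 4]mulr_natr divfK ?pnatr_eq0 // /cis cospi sinpi.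
  by apply/eqP; rewrite eq_complex /= oppr0 !eqxx.
have TE d b : Tmx R d b b = if b then (if d then w' else w) else 1.
  by rewrite /Tmx eqxx; case: d.
under eq_bigr do rewrite TE.
rewrite -(pair_bigA _ (fun e1 e2 => if parity (e1, e2) c t z then
  if ~~ parity (e1, e2) true true true then w' else w else 1)) /=.
rewrite -(pair_bigA _ (fun e0 e1 => \prod_(e2 : bool) if parity (e0, e1, e2) c t z then
  if ~~ parity (e0, e1, e2) true true true then w' else w else 1)) /=.
rewrite !big_bool /parity /bsign.
case: c; case: t; case: z; rewrite /= ?(mul1r, mulr1) //.
(* Exactly four of the eight parities are true when the bits are not all false. They comprise two of
   each weight parity, and cancel, unless all three bits are true; then all four have odd weight and
   give [w ^+ 4 = -1]. *)
all: try (transitivity ((w * w') ^+ 2); [by ring | by rewrite ww' expr1n]).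
by rewrite -w4; ring.
Qed.

(** * The circuit, its T-depth and its number of ancillas *)

Section Circuit.
Variables (R : realType) (n : nat) (P Q : bits n -> bits n).
Hypotheses (PD : {morph P : x y / x + y}) (QD : {morph Q : x y / x + y}).
Hypotheses (PK : cancel P Q) (QK : cancel Q P).

(* For each i there is a target qubit, and for each e an ancilla which
   receives the parity selected by e of the control, this target and a
   coordinate of (1 + Q) y. *)
Let anc : finType := ('I_n + 'I_n * (bool * bool * bool))%type.
Let K := #|anc|.
Let m := ((1 + n) + K)%N.

Let qc : 'I_m := lshift K (lshift n ord0).
Let qy (k : 'I_n) : 'I_m := lshift K (rshift 1 k).
Let qt (i : 'I_n) : 'I_m := rshift (1 + n) (enum_rank (inl i : anc)).
Let qa (j : 'I_n * (bool * bool * bool)) : 'I_m :=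
  rshift (1 + n) (enum_rank (inr j : anc)).

(** The last list is row [j.1] of the matrix of 1 + Q, in the form used by [lin_coord]. *)
Let ancilla_sources (j : 'I_n * (bool * bool * bool)) : seq 'I_m :=
  (if j.2.1.1 then [:: qc] else [::]) ++ (if j.2.1.2 then [:: qt j.1] else [::]) ++
  (if j.2.2 then [seq qy k | k <- enum 'I_n & (basis_bits k + Q (basis_bits k)) j.1]
   else [::]).

Let parities : cnot_circuit m :=
  [seq (s, qa j) | j <- enum {: 'I_n * (bool * bool * bool)}, s <- ancilla_sources j].

Let adds : cnot_circuit m := [seq (qt i, qy i) | i <- enum 'I_n].

Let layer : {ffun 'I_m -> option bool} :=
  [ffun q => match fintype.split q with
             | inr r => if enum_val r is inr j then Some (~~ parity j.2 true true true)
                        else None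
             | inl _ => None
             end].

(** Coordinate [k] of the transpose of 1 + P applied to the outcomes: it tells whether the
    correcting sign involves a CZ between the control and [qy k]. *)
Let correct (k : 'I_n) (h : seq bool) : bool :=
  \sum_(i < n) nth false h i * (basis_bits k + P (basis_bits k)) i.

(** [parities] occurs twice: the block is an involution, so the gates that compute the parities for
    the layer also erase them. *)
Definition ctrl_circuit : circuit m :=
  [seq Cliff xpredT (Hgate (qt i)) | i <- enum 'I_n]
  ++ [seq Cliff xpredT (CNOT g.1 g.2) | g <- parities]
  ++ TLayer layer
  :: [seq Cliff xpredT (CNOT g.1 g.2) | g <- parities]
  ++ [seq Cliff xpredT (Hgate (qt i)) | i <- enum 'I_n]
  ++ [seq Cliff xpredT (CNOT g.1 g.2) | g <- adds]
  ++ [seq Meas PauliX (qt i) | i <- enum 'I_n]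
  ++ flatten [seq [seq Cliff (correct k) g
       | g <- [:: Hgate (qy k); CNOT qc (qy k); Hgate (qy k)]] | k <- enum 'I_n].

Let rinj := @rshift_inj (1 + n) K.
Let linj := @lshift_inj (1 + n) K.

Let qt_inj : injective qt.
Proof. by move=> i j /rinj/enum_rank_inj[]. Qed.

Let qc_qy k : qc != qy k.
Proof. by rewrite (inj_eq linj) eq_lrshift. Qed.
Let qc_qt i : qc != qt i.
Proof. by rewrite eq_lrshift. Qed.
Let qc_qa j : qc != qa j.
Proof. by rewrite eq_lrshift. Qed.
Let qy_qt k i : qy k != qt i.
Proof. by rewrite eq_lrshift. Qed.
Let qy_qa k j : qy k != qa j.
Proof. by rewrite eq_lrshift. Qed.
Let qt_qa i j : qt i != qa j.
Proof. by rewrite (inj_eq rinj) (inj_eq enum_rank_inj). Qed.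
Let qa_eq i j : (qa i == qa j) = (i == j).
Proof. by rewrite (inj_eq rinj) (inj_eq enum_rank_inj). Qed.

Let in_sources j s : s \in ancilla_sources j ->
  [\/ s = qc, exists i, s = qt i | exists k, s = qy k].
Proof.
rewrite !mem_cat => /or3P[]; case: ifP => // _.
- by rewrite inE => /eqP ->; constructor 1.
- by rewrite inE => /eqP ->; constructor 2; exists j.1.
- by case/mapP => k _ ->; constructor 3; exists k.
Qed.

Let source_qa j s i : s \in ancilla_sources j -> s != qa i.
Proof. by case/in_sources => [->|[k ->]|[k ->]]. Qed.

Let parities_bip g h : g \in parities -> h \in parities -> g.1 != h.2.
Proof.
case/allpairsPdep => j [s [_ sj ->]] /allpairsPdep[j' [s' [_ _ ->]]] /=.
exact: source_qa sj.
Qed.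

Let adds_bip g h : g \in adds -> h \in adds -> g.1 != h.2.
Proof. by case/mapP => i _ -> /mapP[j _ ->]; rewrite eq_sym qy_qt. Qed.

Lemma ctrl_circuit_ok : circuit_ok ctrl_circuit.
Proof.
have cnots_ok (W : cnot_circuit m) :
    (forall g h, g \in W -> h \in W -> g.1 != h.2) ->
    circuit_ok [seq Cliff xpredT (CNOT g.1 g.2) | g <- W].
  by move=> H; rewrite /circuit_ok all_map; apply/allP => g gW; apply: H.
rewrite /circuit_ok /ctrl_circuit !all_cat.
rewrite -![all _ (map _ parities)]/(circuit_ok _) /= !all_cat.
rewrite -![all _ (map _ parities)]/(circuit_ok _).
rewrite -![all _ (map _ adds)]/(circuit_ok _) !cnots_ok //.
rewrite all_map (eq_all (a2 := predT)) ?all_predT //= all_map (eq_all (a2 := predT)) ?all_predT //=.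
by elim: (enum 'I_n) => //= k s ->; rewrite qc_qy.
Qed.

Let layer_qa j : layer (qa j) = Some (~~ parity j.2 true true true).
Proof. by rewrite ffunE (unsplitK (inr (enum_rank (inr j : anc)))) enum_rankK. Qed.

Let layer_other q : (forall j, q != qa j) -> layer q = None.
Proof.
rewrite ffunE; case: (split_ordP q) => [//|r ->] qN; case E: (enum_val r) => [//|j].
by have := qN j; rewrite /qa -E enum_valK eqxx.
Qed.

(** Serves both [tdepth] and [nmeas], which ignore Clifford gates. *)
Let count_circuit (a : pred (instr m)) : (forall p g, ~~ a (Cliff p g)) ->
  count a ctrl_circuit = (a (TLayer layer) + count a [seq Meas PauliX (qt i) | i <- enum 'I_n])%N.
Proof.
move=> aN.
have cN (T : Type) p (f : T -> clifford m) s : count a [seq Cliff p (f x) | x <- s] = 0%N.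
  by rewrite count_map (eq_count (a2 := pred0)) ?count_pred0 // => x; exact/negbTE/aN.
rewrite /ctrl_circuit !(count_cat, cN) /= !(count_cat, cN) !add0n count_flatten -map_comp.
rewrite (eq_map (g := fun=> 0%N)) => [|k]; last exact: (cN _ (correct k) id [:: _; _; _]).
by rewrite sumnE big_map big1 // addn0.
Qed.

Lemma tdepth_ctrl_circuit : (0 < n)%N -> tdepth ctrl_circuit = 1%N.
Proof.
move=> n_gt0; rewrite /tdepth count_circuit //.
rewrite count_map (eq_count (a2 := pred0)) ?count_pred0 // addn0.
suff -> : [exists q, layer q != None] by [].
by apply/existsP; exists (qa (Ordinal n_gt0, (true, true, true))); rewrite layer_qa.
Qed.

Lemma nmeas_ctrl_circuit : nmeas ctrl_circuit = n.
Proof.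
rewrite /nmeas count_circuit // count_map (eq_count (a2 := predT)) ?count_predT //.
by rewrite size_enum_ord.
Qed.

(** One target and eight parity ancillas for each [i], as [e] ranges over all subsets of three bits,
    the empty one included. *)
Lemma card_ancillas : K = (n * 9)%N.
Proof. by rewrite /K /anc card_sum !card_prod card_ord card_bool; lia. Qed.

(** * Correctness of the circuit *)

Let yb (x : bits m) : bits n := [ffun k => x (qy k)].
Let tb (x : bits m) : bits n := [ffun i => x (qt i)].
Let a0 (x : bits m) : bool := [forall j, ~~ x (qa j)].

Let lbitsE (x : bits m) : lbits x = bits_cat [ffun=> x qc] (yb x).
Proof.
apply/ffunP => q; rewrite [LHS]ffunE; case: (split_ordP q) => k ->.
  by rewrite bits_cat_lshift ffunE (ord1 k).
by rewrite bits_cat_rshift ffunE.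
Qed.

Let rbits_eq0 (x : bits m) :
  (rbits x == [ffun=> false]) = a0 x && [forall i, ~~ x (qt i)].
Proof.
apply/eqP/andP => [x0|[/forallP x1 /forallP x2]].
  have rE r : x (rshift (1 + n) r) = false.
    by have := congr1 (fun v : bits K => v r) x0; rewrite !ffunE.
  by split; apply/forallP => j; rewrite rE.
apply/ffunP => r; rewrite !ffunE -(enum_valK r); apply/negbTE.
by case: (enum_val r) => j; [apply: x2 | apply: x1].
Qed.

Let big_qubits (F : 'I_m -> R[i]) : (forall q, (forall j, q != qa j) -> F q = 1) ->
  \prod_q F q = \prod_j F (qa j).
Proof.
move=> F1; rewrite big_split_ord /= big1 ?mul1r => [|q _]; last first.
  by apply: F1 => j; rewrite eq_lrshift.
rewrite (reindex (@enum_rank anc)) /=; last exact/onW_bij/enum_rank_bij.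
rewrite big_sumType /= big1 ?mul1r // => i _.
exact/F1/qt_qa.
Qed.

Let B (v : bits n) : bits n := v + Q v.
Let D (v : bits n) : bits n := v + P v.

Let BD : {morph B : x y / x + y}.
Proof. by move=> x y; rewrite /B QD addrACA. Qed.
Let DD : {morph D : x y / x + y}.
Proof. by move=> x y; rewrite /D PD addrACA. Qed.

Let parities_qa (x : bits m) j : cnot_perm parities x (qa j) =
  x (qa j) + parity j.2 (x qc) (x (qt j.1)) (B (yb x) j.1).
Proof.
rewrite cnot_perm_bipartite // ffunE; congr (_ + _).
rewrite big_mkcond big_allpairs_dep /= big_enum /= (bigD1 j) //= [X in _ + X]big1 ?addr0.
  rewrite (eq_bigr (fun s => x s)) => [|s _]; last by rewrite eqxx.
  rewrite !big_cat /= addrA /parity -![_ (+) _]/(_ + _).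
  congr (_ + _ + _).
  - by case: (j.2.1.1); rewrite ?big_seq1 ?big_nil.
  - by case: (j.2.1.2); rewrite ?big_seq1 ?big_nil.
  - case: (j.2.2); last by rewrite big_nil.
    rewrite big_map big_filter big_enum_cond /= (lin_coord _ _ BD).
    by apply: eq_bigr => k _; rewrite ffunE.
by move=> i ij; rewrite big1 // => s _; rewrite qa_eq (negPf ij).
Qed.

(** With clean parity ancillas, the eight gates sharing an index [i] see all parities of the
    control, target [i] and coordinate [i] of [B y], so they form the CCZ gate of [ccz_phase]. *)
Let layer_phase (x : bits m) : a0 x ->
  \prod_q (if layer q is Some d then
             Tmx R d (cnot_perm parities x q) (cnot_perm parities x q) else 1)
  = \prod_i bsign R [&& x qc, x (qt i) & B (yb x) i].
Proof.
move=> /forallP ax; rewrite big_qubits => [|q /layer_other -> //].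
under [RHS]eq_bigr do rewrite -ccz_phase.
rewrite pair_bigA; apply: eq_bigr => j _.
by rewrite layer_qa parities_qa (negbTE (ax j)) add0r.
Qed.

Let adds_other (x : bits m) q : (forall k, q != qy k) -> cnot_perm adds x q = x q.
Proof.
move=> qN; rewrite cnot_perm_bipartite // ffunE big_seq_cond big1 ?addr0 //.
by move=> g /andP[/mapP[k _ ->]] /=; rewrite eq_sym (negPf (qN k)).
Qed.

Let yb_adds (x : bits m) : yb (cnot_perm adds x) = yb x + tb x.
Proof.
apply/ffunP => k; rewrite !ffunE cnot_perm_bipartite // ffunE; congr (_ + _).
rewrite big_map big_enum_cond /= (big_pred1 k) => [|i] //=.
Qed.

(** Here [y] is the new value of the register and [v = y + t] the old one: [t = v + Q v] means
    [y = Q v], that is [v = P y], and then [t = y + P y]. *)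
Let adds_shift (y t : bits n) : (t == B (y + t)) = (t == D y).
Proof.
have tt v : v + v = 0 :> bits n := addbits_self v.
have addK v w : v + (v + w) = w :> bits n by rewrite addrA tt add0r.
apply/eqP/eqP => [tE|->].
  have : y = Q (y + t).
    by apply: (addrI (y + t)); rewrite -[RHS]/(B (y + t)) -tE addrAC tt add0r.
  move=> /(congr1 P); rewrite QK => Py.
  by rewrite /D Py addK.
by rewrite /D /B addK PK addrC.
Qed.

Let r : R[i] := (sqrtC 2)^-1.

(** The parity ancillas are back in |0>, and target [i] is in the eigenstate of X for the outcome at
    position [i]. *)
Let chi (o : seq bool) : qvec R K :=
  [ffun v : bits K => [forall j, ~~ v (enum_rank (inr j : anc))]%:R *
     \prod_(i < n) (bsign R (nth false o i * v (enum_rank (inl i : anc)))%R * r)].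

(** The vectors [u0] to [u7] follow the circuit block by block, each as a factor free of the targets
    times a product over the targets, the form [apply_each] asks for. The scalar does not depend on
    the outcomes. *)
Lemma ctrl_circuit_run (U : qop R n) (xi : qvec R (1 + n)) (o : seq bool) :
  (forall v y, U v y = v (P y)) -> size o = n ->
  exec ctrl_circuit [::] o (tensor xi (ket R [ffun=> false])) =
  r ^+ n *: tensor (ctrl U xi) (chi o).
Proof.
move=> UE so; apply/ffunP => x.
pose f z := xi (lbits z) * (a0 z)%:R.
have lbits_set z i b : lbits (bits_set z (qt i) b) = lbits z.
  by apply/ffunP => k; rewrite [LHS]ffunE bits_set_other ?eq_lrshift // [RHS]ffunE.
have a0_set z i b : a0 (bits_set z (qt i) b) = a0 z.
  by apply: eq_forallb => j; rewrite bits_set_other // eq_sym.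
have yb_set z i b : yb (bits_set z (qt i) b) = yb z.
  by apply/ffunP => k; rewrite [LHS]ffunE bits_set_other // [RHS]ffunE.
have qc_set z i b : bits_set z (qt i) b qc = z qc by rewrite bits_set_other.
have f_set z i b : f (bits_set z (qt i) b) = f z by rewrite /f lbits_set a0_set.
set u0 := tensor xi _.
have u0E z : u0 z = f z * \prod_(i < n) (~~ z (qt i))%:R.
  by rewrite tensorE [ket _ _ _]ffunE rbits_eq0 prod_bool /f -mulrA -natrM mulnb.
rewrite /ctrl_circuit exec_hadamards.
set u1 := foldl _ _ _.
have u1E z : u1 z = f z * \prod_(i < n) r.
  rewrite (apply_each (fun=> @Hmx R) (g := fun i z b => (~~ b)%:R) qt_inj f_set _ u0E) //.
  congr (_ * _); apply: eq_bigr => i _.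
  by rewrite big_bool /= mulr0 add0r mulr1 /Hmx andbF mul1r.
rewrite exec_cnots [exec _ _ _ _]/= exec_cnots exec_hadamards.
set u4 := cnot_unitary R parities _.
have u4E z : u4 z = f z * \prod_(i < n) (bsign R [&& z qc, z (qt i) & B (yb z) i] * r).
  rewrite /u4 cnot_unitaryE apply_layerE cnot_unitaryE cnot_perm_bipartiteK // u1E /f.
  case: (boolP (a0 z)) => az; last by rewrite !(mulr0, mul0r).
  by rewrite layer_phase // big_split /= [LHS]mulrCA.
set u5 := foldl _ _ _.
(* The Hadamard gate turns the sign (-1)^(t s) in a target bit t into the basis state |s>: the
   targets now hold B y if the control is 1, and 0 otherwise. *)
have u5E z : u5 z = f z * \prod_(i < n) (z (qt i) == z qc && B (yb z) i)%:R.
  rewrite (apply_each (fun=> @Hmx R)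
    (g := fun i z b => bsign R [&& z qc, b & B (yb z) i] * r) qt_inj f_set _ u4E).
    congr (_ * _); apply: eq_bigr => i _; rewrite big_bool /= /Hmx -/r.
    have key w : w = 2 * (r * r) * w by rewrite /r invsqrt2_sqr mulfV ?pnatr_eq0 // mul1r.
    rewrite [RHS]key; case: (z qc); case: (z (qt i)); case: (B _ i); rewrite /bsign /=; ring.
  by move=> j {}z i b c; rewrite qc_set yb_set.
rewrite exec_cnots.
set u6 := cnot_unitary R adds _.
(* In terms of the new [y], the first register already carries [ctrl U xi], and what remains is to
   disentangle the targets. *)
pose F z := ctrl U xi (lbits z) * (a0 z)%:R.
have u6E z : u6 z = F z * \prod_(i < n) (z (qt i) == z qc && D (yb z) i)%:R.
  rewrite /u6 cnot_unitaryE u5E yb_adds /f /F.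
  have qt_qy i k : qt i != qy k by rewrite eq_sym.
  rewrite adds_other //; under eq_bigr do rewrite (adds_other _ (qt_qy _)).
  have -> : a0 (cnot_perm adds z) = a0 z.
    by apply: eq_forallb => j; rewrite adds_other // => k; rewrite eq_sym.
  rewrite lbitsE yb_adds adds_other // !prod_bool (ctrl_permE _ _ UE).
  have -> : rbits (lbits z) = yb z by apply/ffunP => k; rewrite !ffunE.
  have -> : lbits (lbits z) = [ffun=> z qc] by apply/ffunP => k; rewrite !ffunE (ord1 k).
  rewrite ffunE.
  have shiftE (V : bits n) : [forall i, z (qt i) == z qc && V i] =
      (tb z == if z qc then V else 0).
    apply/forallP/eqP => [H|tE i].
      by apply/ffunP => i; rewrite ffunE (eqP (H i)); case: (z qc); rewrite ?ffunE.
    have := congr1 (fun v : bits n => v i) tE; rewrite ffunE => ->.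
    by case: (z qc); rewrite ?ffunE.
  rewrite !shiftE; case: (z qc).
    rewrite adds_shift; case: eqP => [->|_]; last by rewrite !mulr0.
    by rewrite /D addrA addbits_self add0r.
  by case: eqP => [->|_]; rewrite ?addr0 // !mulr0.
have oE : [seq nth false o i | i : 'I_n <- enum 'I_n] = o.
  by rewrite -{2}(mkseq_nth false o) so /mkseq -val_enum_ord -map_comp.
rewrite -[X in exec _ _ X _](cats0 o) -[X in exec _ _ (X ++ _) _]oE.
rewrite exec_measurements cat0s oE.
set u7 := foldl _ _ _.
have F_set z i b : F (bits_set z (qt i) b) = F z by rewrite /F lbits_set a0_set.
(* Projecting |s> on the outcome o of X gives amplitude (-1)^(o (t + s)) / 2 at each t; [r * r] is
   the factor 1 / 2. *)
have u7E z : u7 z = F z *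
    \prod_(i < n) (bsign R (nth false o i * (z (qt i) + (z qc && D (yb z) i)))%R * (r * r)).
  rewrite (apply_each (fun i : 'I_n => @Defs.proj_mx R PauliX (nth false o i))
    (g := fun i z b => (b == z qc && D (yb z) i)%:R) qt_inj F_set _ u6E).
    congr (_ * _); apply: eq_bigr => i _; rewrite /r invsqrt2_sqr big_bool /= /Defs.proj_mx /=.
    case: (nth _ _ _); case: (z (qt i)); case: (z qc && _); rewrite /bsign /=; ring.
  by move=> j {}z i b c; rewrite qc_set yb_set.
rewrite exec_cz // u7E big_enum /=.
(* Exchanging the sums moves the transpose of [D] from the outcomes to [y]. *)
have -> : \sum_k correct k o * (x qc * x (qy k)) =
   \sum_(i < n) nth false o i * (x qc && D (yb x) i).
  under eq_bigr do rewrite big_distrl /=.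
  rewrite exchange_big; apply: eq_bigr => i _ /=.
  have andE (a b : bool) : a && b = a * b by [].
  rewrite (lin_coord _ _ DD) andE !big_distrr /= [RHS]big_mkcond.
  apply: eq_bigr => k _; rewrite [yb x k]ffunE -/(D _).
  by case: (nth _ _ _); case: (D _ i); case: (x qc); case: (x _).
rewrite bsign_prod mulrCA [RHS]ffunE tensorE /F -!mulrA [RHS]mulrCA; congr (_ * _).
rewrite [chi o _]ffunE [RHS]mulrCA; congr (_ * _).
  by congr ((nat_of_bool _)%:R); apply: eq_forallb => j; rewrite ffunE.
have -> : r ^+ n = \prod_(i < n) r by rewrite prodr_const card_ord.
rewrite -!big_split; apply: eq_bigr => i _ /=.
rewrite [rbits x _]ffunE -/(qt i) mulrDr bsignD.
(* [a] is the unwanted sign, present once from the measurement and once from the correction; [b]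
   belongs to [chi o]. *)
move: (bsign R (_ * x (qt i)))%R => b; set a := bsign R _.
have aa : a * a = 1 by rewrite /a /bsign -signr_addb addbb.
by transitivity (a * a * (r * (b * r))); [ring | rewrite aa mul1r].
Qed.

Let norm_r : `|r| = r.
Proof. by rewrite ger0_norm // invr_ge0 sqrtC_ge0 ler0n. Qed.

Let qnorm_chi o : qnorm (chi o) = 1.
Proof.
have chiE v : `|chi o v| ^+ 2 = if [forall j, ~~ v (enum_rank (inr j : anc))]
                                then 2^-1 ^+ n else 0.
  rewrite ffunE; case: ifP => _; last by rewrite mul0r normr0 expr0n.
  rewrite mul1r normr_prod -prodrXl (eq_bigr (fun=> 2^-1)) => [|i _].
    by rewrite prodr_const card_ord.
  by rewrite normrM norm_r /bsign normrX normrN1 expr1n mul1r expr2 /r invsqrt2_sqr.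
rewrite /qnorm (eq_bigr _ (fun v _ => chiE v)) -big_mkcond.
(* The image of [h] is the support of [chi o]: 2 ^ n strings, each of weight 2 ^ -n. *)
pose h (t : bits n) : bits K :=
  [ffun a => if enum_val a is inl i then t i else false].
pose h' (v : bits K) : bits n := [ffun i => v (enum_rank (inl i : anc))].
have hK : cancel h h' by move=> t; apply/ffunP => i; rewrite !ffunE enum_rankK.
rewrite (reindex_onto h h') => [|v /forallP v0].
  rewrite (eq_bigl predT) => [|t]; last first.
    rewrite hK eqxx andbT; apply/forallP => j; by rewrite ffunE enum_rankK.
  rewrite sumr_const card_ffun card_bool card_ord -[_ *+ _]mulr_natr natrX -exprMn.
  by rewrite mulVf ?expr1n ?sqrtC1 // pnatr_eq0.
apply/ffunP => a; rewrite ffunE -{2}(enum_valK a).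
by case: (enum_val a) => j; rewrite ?ffunE // (negbTE (v0 j)).
Qed.

Lemma ctrl_circuit_implements (U : qop R n) : (forall v y, U v y = v (P y)) ->
  implements ctrl_circuit (ctrl U).
Proof.
move=> UE o; rewrite nmeas_ctrl_circuit => so.
exists 0, (chi o); split; first exact: qnorm_chi.
move=> xi xi1; cbv zeta; rewrite (ctrl_circuit_run xi UE so) => qn0.
have tensor1 : qnorm (tensor (ctrl U xi) (chi o)) = 1.
  rewrite qnorm_tensor qnorm_chi mulr1 -xi1.
  (* [shift P] is a permutation with inverse [shift Q], so [ctrl U] preserves the norm.
     Normalization then divides by exactly [r ^+ n], which is why the global phase is 0. *)
  pose shift (V : bits n -> bits n) (x : bits (1 + n)) : bits (1 + n) :=
    bits_cat (lbits x) (if lbits x ord0 then V (rbits x) else rbits x).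
  have shiftK V V' : cancel V V' -> cancel (shift V) (shift V').
    move=> VK x; rewrite /shift lbits_cat rbits_cat -[RHS]bits_catK.
    by case: (lbits x ord0); rewrite ?VK.
  rewrite -(qnorm_perm xi (shiftK _ _ PK) (shiftK _ _ QK)).
  by congr qnorm; apply/ffunP => x; rewrite (ctrl_permE _ _ UE) [RHS]ffunE.
move: qn0; rewrite qnormZ tensor1 mulr1 normrX norm_r => rn0.
by rewrite scalerA mulVf // scale1r cis0 scale1r.
Qed.

End Circuit.

(** * Approximation of angles and size of the catalyst *)

Lemma cnot_mapK m (c t : 'I_m) : c != t -> involutive (cnot_map c t).
Proof.
move=> ct x; rewrite /cnot_map bits_set_set bits_set_same bits_set_other //.
by rewrite -addbA addbb addbF bits_set_id.
Qed.

(** Each gate is its own inverse. The reversed circuit provides the map [Q] for [ctrl_circuit]. *)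
Lemma cnot_permK m (W : cnot_circuit m) : cnot_circuit_ok W ->
  cancel (cnot_perm W) (cnot_perm (rev W)).
Proof.
elim: W => // g W IH /andP[gok Wok] x.
have gK : cnot_perm [:: g] (cnot_perm (g :: W) x) = cnot_perm W x := cnot_mapK gok _.
by rewrite rev_cons -cats1 cnot_perm_cat gK IH.
Qed.

Lemma cnot_perm_revK m (W : cnot_circuit m) : cnot_circuit_ok W ->
  cancel (cnot_perm (rev W)) (cnot_perm W).
Proof. by rewrite /cnot_circuit_ok -all_rev => /cnot_permK; rewrite revK. Qed.

(** The hypothesis speaks of all multiples of [psi] because linearity is not part of [qop], and [U]
    is applied to the slice [b *: psi]. *)
Lemma ctrl_eigenvector (R : realType) n (U : qop R n) (psi : qvec R n) (mu : R[i]) (a b : R[i]) :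
  (forall c : R[i], U (c *: psi) = (c * mu) *: psi) ->
  ctrl U (tensor (qubit a b) psi) = tensor (qubit a (b * mu)) psi.
Proof.
move=> UE.
have sliceE (c : bool) : slice c (tensor (qubit a b) psi) = (if c then b else a) *: psi.
  apply/ffunP => y; rewrite [LHS]ffunE tensorE lbits_cat rbits_cat qubitE ffunE.
  by rewrite [RHS]ffunE.
rewrite /ctrl !sliceE UE; apply/ffunP => x.
rewrite [LHS]ffunE !tensorE !qubitE [(a *: psi) _]ffunE [((b * mu) *: psi) _]ffunE.
by case: (lbits x ord0); rewrite !(mul0r, mul1r, add0r, addr0).
Qed.

Lemma ln2_gt0 (R : realType) : 0 < ln 2 :> R.
Proof. by apply: ln_gt0; lra. Qed.

Lemma catalyst_size_itv (R : realType) (eps : R) : 0 < eps -> eps <= 1 ->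
  ln (8 / eps) / ln 2 <= (catalyst_size eps)%:R < ln (8 / eps) / ln 2 + 1.
Proof.
move=> e0 e1; set z := ln _ / _.
(* Since [eps <= 1], the ceiling is nonnegative and the absolute value in [catalyst_size] leaves it
   unchanged. *)
have z0 : 0 <= z.
  apply: divr_ge0; last exact: ltW (ln2_gt0 R).
  by apply: ln_ge0; rewrite ler_pdivlMr // mul1r; lra.
have c0 : 0 <= Num.ceil z by rewrite ceil_ge0; lra.
have -> : (catalyst_size eps)%:R = (Num.ceil z)%:~R :> R.
  by rewrite -[in RHS](gez0_abs c0).
by have /andP[] := ceil_itv z; rewrite intrD => h ->; rewrite /= ; lra.
Qed.

Lemma catalyst_size_exp (R : realType) (eps : R) : 0 < eps -> eps <= 1 ->
  8 / eps <= 2 ^+ catalyst_size eps.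
Proof.
move=> e0 e1; have /andP[+ _] := catalyst_size_itv e0 e1.
rewrite ler_pdivrMr ?ln2_gt0 // [_ * ln 2]mulr_natl -lnXn // ler_ln ?posrE ?divr_gt0 ?exprn_gt0 //.
Qed.

(* The angles 2 pi k / N are at distance at most pi / N <= 4 eps / 7 from any
   alpha, since N + 1 = 2 ^ n >= 8 / eps. *)
Lemma angle_approx (R : realType) (eps alpha N : R) :
  0 < eps -> eps <= 1 -> 0 <= alpha -> 8 / eps <= N + 1 ->
  exists k : nat, `|alpha - 2 * pi * k%:R / N| < eps.
Proof.
move=> e0 e1 a0 hN.
have pi0 : 0 < pi :> R := pi_gt0 R.
have pi4 : pi < 4 :> R by have := pihalf_lt2 R; lra.
move: (pi : R) pi0 pi4 => p p0 p4.
have eN : 7 <= N * eps.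
  by move: hN; rewrite ler_pdivrMr //; nra.
have N0 : 0 < N by nra.
(* Adding one half makes truncation round to a nearest integer, so the error is at most half a
   step. *)
pose z := alpha * N / (2 * p) + 2^-1.
have z0 : 0 <= z by rewrite addr_ge0 ?invr_ge0 // divr_ge0 ?mulr_ge0 //; lra.
exists (Num.truncn z).
have /andP[] := truncn_itv z0; set k := Num.truncn z; rewrite -natr1 /z => h1 h2.
have aE : alpha = 2 * p * (alpha * N / (2 * p)) / N.
  by field; rewrite !gt_eqF.
set y := alpha * N / (2 * p) in aE h1 h2.
have -> : alpha - 2 * p * k%:R / N = 2 * p * (y - k%:R) / N by rewrite {1}aE; field; rewrite gt_eqF.
rewrite normrM normfV (gtr0_norm N0) ltr_pdivrMr // normrM gtr0_norm; last by lra.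
have : `|y - k%:R| <= 2^-1 by rewrite ler_norml; lra.
by have := normr_ge0 (y - k%:R); nra.
Qed.

Lemma catalyst_size_bigO (R : realType) (K : nat) :
  (fun eps : R => (K * catalyst_size eps)%:R : R^o)
    =O_ ((0 : R)^'+) (fun eps : R => ln (eps^-1) : R^o).
Proof.
apply/eqOP; near=> k; near=> eps.
have e0 : 0 < eps by near: eps; exact: nbhs_right_gt.
have e2 : eps < 2^-1 by near: eps; apply: nbhs_right_lt; lra.
have l2 := ln2_gt0 R.
have /andP[_] : ln (8 / eps) / ln 2 <= (catalyst_size eps)%:R < ln (8 / eps) / ln 2 + 1.
  by apply: catalyst_size_itv; lra.
have le : ln 2 <= ln eps^-1.
  by rewrite ler_ln ?posrE ?invr_gt0 // -[leLHS]invrK lef_pV2 ?posrE ?invr_gt0 //; lra.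
have -> : ln (8 / eps) = 3 * ln 2 + ln eps^-1.
  rewrite lnM ?posrE ?invr_gt0 // (_ : 8 = 2 ^+ 3); last by ring.
  by rewrite lnXn // mulr_natl.
move=> h.
rewrite ger0_norm ?ler0n // ger0_norm; last by lra.
(* With L = ln (1 / eps), the size is below 4 + L / ln 2, which is at most 5 L / ln 2 because ln 2
   <= L. *)
have hk : 5 * K%:R / ln 2 <= k by near: k; apply: nbhs_pinfty_ge; rewrite num_real.
have nL : (catalyst_size eps)%:R <= 5 * ln eps^-1 / ln 2.
  apply: (le_trans (ltW h)); rewrite ler_pdivlMr // mulrDl divfK ?gt_eqF //; lra.
rewrite natrM; apply: (@le_trans _ _ (5 * K%:R / ln 2 * ln eps^-1)).
  have -> : 5 * K%:R / ln 2 * ln eps^-1 = K%:R * (5 * ln eps^-1 / ln 2) by ring.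
  by rewrite ler_wpM2l.
by rewrite ler_wpM2r //; lra.
Unshelve. all: by end_near.
Qed.

Theorem mainTheorem7 (R : realType) :
  exists K : nat,
    (forall eps : R, 0 < eps -> eps <= 1 ->
       let n := catalyst_size eps in
       exists psi : qvec R n, qnorm psi = 1 /\
       forall alpha : R, 0 <= alpha -> alpha < 2 * pi ->
       exists (W : cnot_circuit n) (beta : R),
         [/\ cnot_circuit_ok W,
             `|alpha - beta| < eps,
             forall a b : R[i],
               ctrl (cnot_unitary R W) (tensor (qubit a b) psi)
               = tensor (qubit a (b * cis beta)) psi
           & exists (k : nat) (C : circuit ((1 + n) + k)),
             [/\ (k <= K * n)%N, circuit_ok C, tdepth C = 1%N
               & implements C (ctrl (cnot_unitary R W))]])
    /\ (fun eps : R => (K * catalyst_size eps)%:R : R^o)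
         =O_ ((0 : R)^'+) (fun eps : R => ln (eps^-1) : R^o).
Proof.
(* The nine ancillas per catalyst qubit of [card_ancillas]. *)
exists 9%N; split; last exact: catalyst_size_bigO.
move=> eps e0 e1 n.
have n_exp : 8 / eps <= 2 ^+ n := catalyst_size_exp e0 e1.
have n_gt0 : (0 < n)%N.
  rewrite lt0n; apply/eqP => n0; move: n_exp.
  by rewrite n0 expr0 ler_pdivrMr //; lra.
have [psi [psi1 psiW]] := catalyst_state R n_gt0.
exists psi; split => // alpha a0 _.
have [|k hk] := @angle_approx R eps alpha (2 ^ n).-1%:R e0 e1 a0.
  by rewrite natr1 prednK ?expn_gt0 // natrX.
have [W Wok WE] := psiW k.
exists W, (2 * pi * k%:R / (2 ^ n).-1%:R); split => // [a b|].
  apply: ctrl_eigenvector => c; rewrite -scalerA -WE.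
  by apply/ffunP => x; rewrite cnot_unitaryE [LHS]ffunE [RHS]ffunE cnot_unitaryE.
exists _, (ctrl_circuit (cnot_perm W) (cnot_perm (rev W))).
split; [by rewrite card_ancillas mulnC | exact: ctrl_circuit_ok | exact: tdepth_ctrl_circuit |].
apply: ctrl_circuit_implements (cnot_permK Wok) (cnot_perm_revK Wok) _ _;
  [exact: cnot_permD | exact: cnot_permD | exact: cnot_unitaryE].
Qed.
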